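(* For every odd positive integer $n$, $$A_n = \frac{8}{2^{n-1}\pi} \sum_{j=0}^{(n-1)/2} \binom{n}{j}\frac{1}{(n-2j)^2}.$$
   Context: For a positive integer $n$, $A_n$ denotes the limiting area between the graphs of $\cos^n x$ and $\cos^n kx$ over $[0,\pi]$: $$A_n = \lim_{k \to \infty} \int_0^\pi \big| \cos^n x - \cos^n (kx) \big| \, dx,$$ where $k$ runs through the positive integers (both parities). Here $\cos^n \theta = (\cos\theta)^n$. The claim includes that this limit exists. *)

(* Defs.v *)
From Stdlib Require Import Reals.
From Coquelicot Require Import Coquelicot.

(* Main.v *)
Require Import Defs.
From Stdlib Require Import Reals Arith Lra Lia.
From Coquelicot Require Import Coquelicot.
Open Scope R_scope.

(** For large [k] the function [cos (k x)] runs through many half periods while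
    [cos x] hardly moves, so the phase [k x] behaves like an independent variable
    [y], uniformly distributed on [[0, PI]], and the integral tends to the mean

      [(1 / PI) * int_0^PI int_0^PI |cos x ^ n - cos y ^ n| dy dx].

    [is_lim_seq_RInt_oscillation] makes this precise, with an error O(1/k), by
    cutting [[0, PI]] into the [k] half periods of [cos (k x)]: on each of them
    [x] may be frozen at the cost of a Lipschitz error, and the frozen integral is
    exactly a rescaled integral over [y].

    For odd [n] the function [g x = cos x ^ n] decreases on [[0, PI]], so the sign
    of [g x - g y] is that of [y - x] and the absolute value disappears.  If [F] is
    an antiderivative of [g] vanishing at both ends, two integrations turn the
    double integral into [4 * int_0^PI F] ([RInt_RInt_dist_decreasing]).

    Finally the finite Fourier expansion of [cos x ^ n] ([cos_pow_fourier]) gives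
    [F] termwise: every frequency [n - 2 j] is odd, so [sin ((n - 2 j) x)] vanishes
    at [0] and [PI], and its integral over [[0, PI]] is [2 / (n - 2 j)].  The two
    divisions by [n - 2 j], one in [F] and one in its integral, produce the square
    in the formula.  The terms [j] and [n - j] agree, which folds the sum over
    [0 .. n] to half its length. *)

(** * Continuity and integration of real functions *)

Lemma ex_RInt_continuous_all (f : R -> R) (a b : R) :
  (forall x, continuous f x) -> ex_RInt f a b.
Proof. intros Hf; apply (ex_RInt_continuous (V := R_CompleteNormedModule)); auto. Qed.

Lemma lipschitz_continuous (f : R -> R) (L : R) :
  (forall x y, Rabs (f x - f y) <= L * Rabs (x - y)) ->
  forall x, continuous f x.
Proof.
  intros Hf x; apply continuity_pt_filterlim.
  intros eps Heps.
  assert (HL : 0 < Rabs L + 1) by (generalize (Rabs_pos L); lra).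
  exists (eps / (Rabs L + 1)); split; [now apply Rdiv_lt_0_compat|].
  intros y [_ Hy]; unfold dist in *; simpl in *; unfold R_dist in *.
  apply Rle_lt_trans with (1 := Hf y x).
  apply Rle_lt_trans with ((Rabs L + 1) * Rabs (y - x)).
  - apply Rmult_le_compat_r; [apply Rabs_pos|]. generalize (Rle_abs L); lra.
  - apply Rlt_le_trans with ((Rabs L + 1) * (eps / (Rabs L + 1))).
    + now apply Rmult_lt_compat_l.
    + right; field; lra.
Qed.

Lemma continuous_Rabs_minus (u v : R -> R) (x : R) :
  continuous u x -> continuous v x -> continuous (fun t => Rabs (u t - v t)) x.
Proof.
  intros Hu Hv; apply continuous_Rabs_comp.
  now apply (continuous_minus (V := R_NormedModule)).
Qed.

Lemma RInt_sub (u v : R -> R) (a b : R) :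
  ex_RInt u a b -> ex_RInt v a b ->
  RInt (fun x => u x - v x) a b = RInt u a b - RInt v a b.
Proof. exact (RInt_minus (V := R_CompleteNormedModule) u v a b). Qed.

Lemma RInt_dist_le (u v : R -> R) (a b M : R) :
  a <= b -> ex_RInt u a b -> ex_RInt v a b ->
  (forall x, a <= x <= b -> Rabs (u x - v x) <= M) ->
  Rabs (RInt u a b - RInt v a b) <= (b - a) * M.
Proof.
  intros Hab Hu Hv HM.
  rewrite <- RInt_sub by easy.
  apply abs_RInt_le_const; [easy| |exact HM].
  now apply (ex_RInt_minus (V := R_NormedModule)).
Qed.

Lemma RInt_split (f : R -> R) (a b c : R) :
  (forall x, continuous f x) -> RInt f a c = RInt f a b + RInt f b c.
Proof.
  intros Hf; symmetry.
  now apply (RInt_Chasles (V := R_CompleteNormedModule)); apply ex_RInt_continuous_all.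
Qed.

Lemma RInt_scal_all (f : R -> R) (c a b : R) :
  (forall x, continuous f x) -> RInt (fun x => c * f x) a b = c * RInt f a b.
Proof.
  intros Hf; apply (RInt_scal (V := R_CompleteNormedModule)).
  now apply ex_RInt_continuous_all.
Qed.

Lemma RInt_dilate (f : R -> R) (c a b : R) :
  (forall x, continuous f x) ->
  c * RInt (fun x => f (c * x)) a b = RInt f (c * a) (c * b).
Proof.
  intros Hf; rewrite <- RInt_scal_all.
  - rewrite <- (Rplus_0_r (c * a)), <- (Rplus_0_r (c * b)).
    rewrite <- (RInt_comp_lin (V := R_CompleteNormedModule)) by now apply ex_RInt_continuous_all.
    apply RInt_ext; intros x _; now rewrite Rplus_0_r.
  - intros x; apply (continuous_comp (fun x => c * x) f); [|apply Hf].
    apply (continuous_scal_r (V := R_NormedModule)), continuous_id.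
Qed.

(** * Averaging over a fast oscillation *)

Lemma RInt_dist_grid (u v : R -> R) (d e : R) (k : nat) :
  (forall x, continuous u x) -> (forall x, continuous v x) ->
  (forall j, (j < k)%nat ->
     Rabs (RInt u (INR j * d) (INR (S j) * d)
           - RInt v (INR j * d) (INR (S j) * d)) <= e) ->
  Rabs (RInt u 0 (INR k * d) - RInt v 0 (INR k * d)) <= INR k * e.
Proof.
  intros Hu Hv; induction k as [|k IH]; intros He.
  - simpl INR; rewrite !Rmult_0_l, !RInt_point.
    unfold zero; simpl; rewrite Rminus_diag, Rabs_R0; lra.
  - rewrite (RInt_split u 0 (INR k * d)), (RInt_split v 0 (INR k * d)) by easy.
    assert (H1 := IH (fun j Hj => He j (Nat.lt_lt_succ_r _ _ Hj))).
    assert (H2 := He k (Nat.lt_succ_diag_r k)).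
    match goal with |- Rabs (?a + ?b - (?c + ?d)) <= _ =>
      replace (a + b - (c + d)) with ((a - c) + (b - d)) by ring end.
    apply Rle_trans with (1 := Rabs_triang _ _).
    replace (INR (S k) * e) with (INR k * e + e) by (rewrite S_INR; ring); lra.
Qed.

Lemma is_lim_seq_dist_inv (u : nat -> R) (l C : R) :
  (forall k, (0 < k)%nat -> Rabs (u k - l) <= C / INR k) -> is_lim_seq u l.
Proof.
  intros Hu.
  assert (Hinv : is_lim_seq (fun k => C / INR k) 0).
  { replace (Finite 0) with (Rbar_mult C (Rbar_inv p_infty))
      by (simpl; now rewrite Rmult_0_r).
    apply is_lim_seq_scal_l, is_lim_seq_inv; [apply is_lim_seq_INR|easy]. }
  apply is_lim_seq_le_le_loc with (fun k => l - C / INR k) (fun k => l + C / INR k).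
  - exists 1%nat; intros k Hk; specialize (Hu k Hk).
    apply Rabs_le_between in Hu; lra.
  - replace (Finite l) with (Finite (l - 0)) by (f_equal; ring).
    apply is_lim_seq_minus'; [apply is_lim_seq_const|exact Hinv].
  - replace (Finite l) with (Finite (l + 0)) by (f_equal; ring).
    apply is_lim_seq_plus'; [apply is_lim_seq_const|exact Hinv].
Qed.

(** Being even and [2 p]-periodic makes [g] symmetric about every multiple of [p];
    reflecting in the point between two adjacent cells exchanges their integrals. *)
Lemma RInt_even_periodic (g : R -> R) (p : R) (j : nat) :
  (forall x, continuous g x) ->
  (forall x, g (- x) = g x) -> (forall x, g (x + 2 * p) = g x) ->
  RInt g (INR j * p) (INR (S j) * p) = RInt g 0 p.
Proof.
  intros Hc He Hp; induction j as [|j IH].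
  - simpl; now rewrite Rmult_0_l, Rmult_1_l.
  - rewrite <- IH.
    assert (Hper : forall m x, g (x + 2 * INR m * p) = g x).
    { induction m as [|m IHm]; intros x.
      - simpl; f_equal; ring.
      - rewrite S_INR, <- (IHm x), <- (Hp (x + 2 * INR m * p)); f_equal; ring. }
    (* the reflection y |-> 2 (j + 1) p - y *)
    assert (H := RInt_comp_lin (V := R_CompleteNormedModule) g (-1)
      (2 * INR (S j) * p) (INR (S j) * p) (INR (S (S j)) * p)
      (ex_RInt_continuous_all _ _ _ Hc)).
    replace (-1 * (INR (S j) * p) + 2 * INR (S j) * p) with (INR (S j) * p) in H by ring.
    replace (-1 * (INR (S (S j)) * p) + 2 * INR (S j) * p) with (INR j * p) in H
      by (rewrite !S_INR; ring).
    rewrite <- (opp_RInt_swap (V := R_CompleteNormedModule) g (INR (S j) * p) (INR j * p)),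
      <- H by now apply ex_RInt_continuous_all.
    rewrite <- (RInt_opp (V := R_CompleteNormedModule)).
    + apply RInt_ext; intros x _.
      rewrite Hper; replace (-1 * x) with (- x) by ring; rewrite He.
      unfold scal, opp; simpl; unfold mult; simpl; ring.
    + apply (ex_RInt_comp_lin (V := R_NormedModule)).
      now apply ex_RInt_continuous_all.
Qed.

(** Averaging of a fast oscillation.  With [G x = int_0^p |f x - g y| dy], compare
    both integrals on the cell from [a = j p / k] to [(j + 1) p / k].  The map
    [x |-> k x] sends the cell onto one half period of [g], so with [f x] frozen at
    [f a] the integral is exactly [G a / k], which is also the integral over the
    cell of the constant [G a / p].  Unfreezing costs at most [L (p / k)^2] on
    either side, and there are [k] cells. *)
Lemma is_lim_seq_RInt_oscillation (f g : R -> R) (L p : R) :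
  0 < p ->
  (forall x y, Rabs (f x - f y) <= L * Rabs (x - y)) ->
  (forall x, continuous g x) ->
  (forall x, g (- x) = g x) -> (forall x, g (x + 2 * p) = g x) ->
  is_lim_seq (fun k : nat => RInt (fun x => Rabs (f x - g (INR k * x))) 0 p)
    (RInt (fun x => RInt (fun y => Rabs (f x - g y)) 0 p) 0 p / p).
Proof.
  intros Hp Hf Hg Heven Hper.
  assert (Hfc := lipschitz_continuous f L Hf).
  assert (HL : 0 <= L).
  { specialize (Hf 1 0); replace (1 - 0) with 1 in Hf by ring.
    rewrite Rabs_R1 in Hf; generalize (Rabs_pos (f 1 - f 0)); lra. }
  set (G := fun x => RInt (fun y => Rabs (f x - g y)) 0 p).
  assert (Hslice : forall c x, continuous (fun y => Rabs (c - g y)) x).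
  { intros c x; apply continuous_Rabs_minus; [apply continuous_const|apply Hg]. }
  assert (Habs : forall x y z, Rabs (Rabs (f x - z) - Rabs (f y - z)) <= L * Rabs (x - y)).
  { intros x y z; apply Rle_trans with (2 := Hf x y).
    replace (f x - f y) with ((f x - z) - (f y - z)) by ring.
    apply Rabs_triang_inv2. }
  assert (HG : forall x y, Rabs (G x - G y) <= (p * L) * Rabs (x - y)).
  { intros x y; replace (p * L * Rabs (x - y)) with ((p - 0) * (L * Rabs (x - y))) by ring.
    apply RInt_dist_le; [lra| | |intros; apply Habs];
      apply ex_RInt_continuous_all, Hslice. }
  assert (HGc := lipschitz_continuous G _ HG).
  apply is_lim_seq_dist_inv with (2 * L * p ^ 2).
  intros k Hk; apply lt_INR in Hk; simpl in Hk.
  assert (Hlin : forall x, continuous (fun x => g (INR k * x)) x).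
  { intros x; apply continuous_comp; [|apply Hg].
    apply (continuous_scal_r (V := R_NormedModule)), continuous_id. }
  set (d := p / INR k).
  assert (Hd : 0 < d) by now apply Rdiv_lt_0_compat.
  replace p with (INR k * d) at 1 2 by (unfold d; field; lra).
  unfold Rdiv at 1; rewrite (Rmult_comm _ (/ p)), <- RInt_scal_all by easy.
  replace (2 * L * p ^ 2 / INR k) with (INR k * (2 * L * d ^ 2)) by (unfold d; field; lra).
  apply RInt_dist_grid.
  { intros x; now apply continuous_Rabs_minus. }
  { intros x; now apply (continuous_scal_r (V := R_NormedModule)). }
  intros j _; set (a := INR j * d); set (b := INR (S j) * d).
  assert (Hb : b - a = d) by (unfold a, b; rewrite S_INR; ring).
  assert (Hcell : d * (/ p * G a) = RInt (fun x => Rabs (f a - g (INR k * x))) a b).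
  { assert (H := RInt_dilate (fun y => Rabs (f a - g y)) (INR k) a b (Hslice _)).
    replace (INR k * a) with (INR j * p) in H by (unfold a, d; field; lra).
    replace (INR k * b) with (INR (S j) * p) in H by (unfold b, d; field; lra).
    rewrite (RInt_even_periodic (fun y => Rabs (f a - g y))) in H;
      [|apply Hslice|intros; now rewrite Heven|intros; now rewrite Hper].
    unfold G; rewrite <- H; unfold d; field; lra. }
  assert (Hconst : d * (/ p * G a) = RInt (fun _ => / p * G a) a b).
  { rewrite (RInt_const (V := R_CompleteNormedModule)), Hb; reflexivity. }
  assert (Hnear : forall x, a <= x <= b -> Rabs (x - a) <= d).
  { intros x Hx; rewrite Rabs_pos_eq; lra. }
  assert (H1 : Rabs (RInt (fun x => Rabs (f x - g (INR k * x))) a b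
     - RInt (fun x => Rabs (f a - g (INR k * x))) a b) <= (b - a) * (L * d)).
  { apply RInt_dist_le; [lra| | |].
    - apply ex_RInt_continuous_all; intros x; now apply continuous_Rabs_minus.
    - apply ex_RInt_continuous_all; intros x.
      apply continuous_Rabs_minus; [apply continuous_const|apply Hlin].
    - intros x Hx; apply Rle_trans with (1 := Habs _ _ _).
      now apply Rmult_le_compat_l; [|apply Hnear]. }
  assert (H2 : Rabs (RInt (fun x => / p * G x) a b
     - RInt (fun _ => / p * G a) a b) <= (b - a) * (L * d)).
  { apply RInt_dist_le; [lra| | |].
    - apply ex_RInt_continuous_all; intros x.
      now apply (continuous_scal_r (V := R_NormedModule)).
    - apply ex_RInt_continuous_all; intros x; apply continuous_const.
    - intros x Hx.
      rewrite <- Rmult_minus_distr_l, Rabs_mult, (Rabs_pos_eq (/ p))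
        by (left; now apply Rinv_0_lt_compat).
      apply Rle_trans with (/ p * (p * L * d)).
      + apply Rmult_le_compat_l; [left; now apply Rinv_0_lt_compat|].
        apply Rle_trans with (1 := HG x a).
        apply Rmult_le_compat_l; [|now apply Hnear].
        apply Rmult_le_pos; lra.
      + right; field; lra. }
  rewrite <- Hcell in H1; rewrite <- Hconst in H2; rewrite Hb in H1, H2.
  apply Rabs_le_between in H1; apply Rabs_le_between in H2.
  apply Rabs_le; lra.
Qed.

(** * Mean distance between the values of a decreasing function *)

(** Splitting the inner integral at [y = x], where [g x - g y] changes sign, gives
    [2 F x + (a + b - 2 x) g x].  This is the derivative of
    [(a + b - 2 x) F x + 4 H x], whose first term vanishes at both ends. *)
Lemma RInt_RInt_dist_decreasing (g F H : R -> R) (a b : R) :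
  a <= b ->
  (forall x, continuous g x) ->
  (forall x y, a <= x -> x <= y -> y <= b -> g y <= g x) ->
  (forall x, is_derive F x (g x)) -> (forall x, is_derive H x (F x)) ->
  F a = 0 -> F b = 0 ->
  RInt (fun x => RInt (fun y => Rabs (g x - g y)) a b) a b = 4 * (H b - H a).
Proof.
  intros Hab Hg Hdec HF HH Fa Fb.
  assert (HFc : forall x, continuous F x).
  { intros x; apply (ex_derive_continuous (V := R_NormedModule)); now exists (g x). }
  assert (Hftc : forall u v, RInt g u v = F v - F u).
  { intros u v; apply is_RInt_unique, (is_RInt_derive (V := R_CompleteNormedModule)); auto. }
  assert (Hinner : forall x, a <= x <= b ->
    RInt (fun y => Rabs (g x - g y)) a b = 2 * F x + (a + b - 2 * x) * g x).
  { intros x Hx.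
    rewrite (RInt_split _ a x b)
      by (intros t; apply continuous_Rabs_minus; [apply continuous_const|apply Hg]).
    rewrite (RInt_ext _ (fun y => g y - g x) a x), (RInt_ext _ (fun y => g x - g y) x b).
    - rewrite !RInt_sub by (try apply ex_RInt_const; now apply ex_RInt_continuous_all).
      rewrite !RInt_const, !Hftc, Fa, Fb.
      unfold scal; simpl; unfold mult; simpl; ring.
    - rewrite Rmin_left, Rmax_right by lra; intros y Hy.
      apply Rabs_pos_eq; assert (g y <= g x) by (apply Hdec; lra); lra.
    - rewrite Rmin_left, Rmax_right by lra; intros y Hy.
      rewrite Rabs_minus_sym.
      apply Rabs_pos_eq; assert (g x <= g y) by (apply Hdec; lra); lra. }
  rewrite (RInt_ext _ (fun x => 2 * F x + (a + b - 2 * x) * g x)).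
  2:{ rewrite Rmin_left, Rmax_right by lra; intros x Hx; apply Hinner; lra. }
  replace (4 * (H b - H a)) with
    (((a + b - 2 * b) * F b + 4 * H b) - ((a + b - 2 * a) * F a + 4 * H a))
    by (rewrite Fa, Fb; ring).
  apply is_RInt_unique.
  apply (is_RInt_derive (V := R_CompleteNormedModule) (fun x => (a + b - 2 * x) * F x + 4 * H x)).
  - intros x _.
    assert (HFx := HF x); assert (HHx := HH x).
    auto_derive.
    + split; [now exists (g x)|split; [now exists (F x)|easy]].
    + change (fun y => F y) with F; change (fun y => H y) with H.
      rewrite (is_derive_unique F x _ HFx), (is_derive_unique H x _ HHx); ring.
  - intros x _.
    apply (continuous_plus (V := R_NormedModule)).
    + now apply (continuous_scal_r (V := R_NormedModule)).
    + apply (continuous_mult (K := R_AbsRing)); [|apply Hg].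
      apply (ex_derive_continuous (V := R_NormedModule)); auto_derive; easy.
Qed.

(** * Fourier expansion of the powers of the cosine *)

(** [Binomial.C n j] is not [0] for [j > n], so Pascal's rule holds only strictly
    inside the range and the two end terms have to be matched separately. *)
Lemma sum_pascal (a : nat -> R) (n : nat) :
  sum_f_R0 (fun j => Binomial.C (S n) j * a j) (S n) =
  sum_f_R0 (fun j => Binomial.C n j * a j) n
  + sum_f_R0 (fun j => Binomial.C n j * a (S j)) n.
Proof.
  destruct n as [|n].
  { simpl; rewrite !C_n_0, C_n_n; ring. }
  rewrite (decomp_sum (fun j => Binomial.C (S n) j * a j)) by lia.
  rewrite (decomp_sum (fun j => Binomial.C (S (S n)) j * a j)) by lia.
  simpl pred; rewrite (tech5 _ n), (tech5 (fun j => Binomial.C (S n) j * a (S j))).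
  rewrite !C_n_0, !C_n_n.
  rewrite (sum_eq (fun i => Binomial.C (S (S n)) (S i) * a (S i))
    (fun i => Binomial.C (S n) (S i) * a (S i) + Binomial.C (S n) i * a (S i))).
  - rewrite sum_plus; ring.
  - intros i Hi; rewrite <- pascal by lia; ring.
Qed.

(** The induction peels off the two outermost terms, [0] and [2 m + 3], so the
    hypothesis is used for the shifted sequence. *)
Lemma sum_fold_half (a : nat -> R) (m : nat) :
  sum_f_R0 a (2 * m + 1) =
  sum_f_R0 (fun j => a j + a (2 * m + 1 - j)%nat) m.
Proof.
  revert a; induction m as [|m IH]; intros a; [reflexivity|].
  replace (2 * S m + 1)%nat with (S (S (2 * m + 1))) by lia.
  rewrite tech5, decomp_sum by lia; rewrite Nat.pred_succ.
  rewrite (decomp_sum _ (S m)) by lia; rewrite Nat.pred_succ.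
  rewrite (IH (fun i => a (S i))).
  rewrite (sum_eq (fun i => a (S i) + a (S (S (2 * m + 1)) - S i)%nat)
                  (fun j => a (S j) + a (S (2 * m + 1 - j)))).
  - rewrite Nat.sub_0_r; ring.
  - intros i Hi; do 2 f_equal; lia.
Qed.

Lemma is_derive_sum_f_R0 (f df : nat -> R -> R) (n : nat) (x : R) :
  (forall j, (j <= n)%nat -> is_derive (f j) x (df j x)) ->
  is_derive (fun x => sum_f_R0 (fun j => f j x) n) x (sum_f_R0 (fun j => df j x) n).
Proof.
  induction n as [|n IH]; intros Hf; simpl; [now apply Hf|].
  apply (is_derive_plus (V := R_NormedModule)); [apply IH|apply Hf]; auto.
Qed.

(** This is the real part of [exp (i t) (exp (i x) + exp (- i x)) ^ n], expanded by
    the binomial formula.  The phase [t] lets the induction stay with cosines alone: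
    one more factor shifts [t] by [x] and by [- x], and
    [cos (t + x) + cos (t - x) = 2 cos x cos t]. *)
Lemma cos_pow_fourier (n : nat) (x t : R) :
  sum_f_R0 (fun j => Binomial.C n j * cos (t + (INR n - 2 * INR j) * x)) n
  = 2 ^ n * cos x ^ n * cos t.
Proof.
  revert t; induction n as [|n IH]; intros t.
  { simpl; rewrite C_n_0; replace (t + (0 - 2 * 0) * x) with t by ring; ring. }
  rewrite (sum_pascal (fun j => cos (t + (INR (S n) - 2 * INR j) * x))).
  rewrite (sum_eq _ (fun j => Binomial.C n j * cos ((t + x) + (INR n - 2 * INR j) * x)))
    by (intros; do 2 f_equal; rewrite S_INR; ring).
  rewrite IH.
  rewrite (sum_eq _ (fun j => Binomial.C n j * cos ((t - x) + (INR n - 2 * INR j) * x)))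
    by (intros; do 2 f_equal; rewrite !S_INR; ring).
  rewrite IH, cos_plus, cos_minus; simpl; ring.
Qed.

(** * The integrand and its frequencies *)

Lemma pow_odd_le (m : nat) (x y : R) : x <= y -> x ^ (2 * m + 1) <= y ^ (2 * m + 1).
Proof.
  intros Hxy.
  assert (Hneg : forall z, (- z) ^ (2 * m + 1) = - z ^ (2 * m + 1)).
  { intros z; rewrite !pow_add, !pow_mult.
    replace ((- z) ^ 2) with (z ^ 2) by ring; ring. }
  destruct (Rle_dec 0 x) as [Hx|Hx]; [now apply pow_incr|].
  destruct (Rle_dec 0 y) as [Hy|Hy].
  - apply Rle_trans with 0; [|now apply pow_le].
    rewrite <- (Ropp_involutive x), Hneg.
    assert (0 <= (- x) ^ (2 * m + 1)) by (apply pow_le; lra); lra.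
  - rewrite <- (Ropp_involutive x), <- (Ropp_involutive y), !(Hneg (- _)).
    apply Ropp_le_contravar, pow_incr; lra.
Qed.

Lemma cos_pow_lipschitz (n : nat) (x y : R) :
  Rabs (cos x ^ n - cos y ^ n) <= INR n * Rabs (x - y).
Proof.
  apply (bounded_variation (fun t => cos t ^ n)
    (fun t => INR n * (- sin t) * cos t ^ pred n)).
  intros t _; split.
  - auto_derive; [easy|ring].
  - rewrite !Rabs_mult, Rabs_Ropp, (Rabs_pos_eq (INR n)), <- RPow_abs by apply pos_INR.
    rewrite Rmult_assoc; rewrite <- (Rmult_1_r (INR n)) at 2.
    apply Rmult_le_compat_l; [apply pos_INR|].
    rewrite <- (Rmult_1_r 1); apply Rmult_le_compat; [apply Rabs_pos| | |].
    + apply pow_le, Rabs_pos.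
    + apply Rabs_le, SIN_bound.
    + rewrite <- (pow1 (pred n)); apply pow_incr; split; [apply Rabs_pos|].
      apply Rabs_le, COS_bound.
Qed.

Lemma odd_minus_double_neq0 (m j : nat) : INR (2 * m + 1) - 2 * INR j <> 0.
Proof.
  replace 2 with (INR 2) by reflexivity; rewrite <- mult_INR; intros H.
  apply Rminus_diag_uniq, INR_eq in H; lia.
Qed.

(** Adding [2 j PI] removes [j] while keeping the argument a natural multiple of
    [PI], the form needed by [cos_period] and [sin_period]. *)
Lemma trig_odd_PI (m j : nat) :
  cos ((INR (2 * m + 1) - 2 * INR j) * PI) = -1 /\
  sin ((INR (2 * m + 1) - 2 * INR j) * PI) = 0.
Proof.
  rewrite <- (cos_period _ j), <- (sin_period _ j).
  replace ((INR (2 * m + 1) - 2 * INR j) * PI + 2 * INR j * PI)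
    with (PI + 2 * INR m * PI) by (rewrite plus_INR, mult_INR; simpl; ring).
  rewrite cos_period, sin_period; split; [apply cos_PI|apply sin_PI].
Qed.

Theorem theorem1 (n : nat) (hn : Nat.Odd n) :
  is_lim_seq (fun k : nat =>
    RInt (fun x : R => Rabs (cos x ^ n - cos (INR k * x) ^ n)) 0 PI)
   (Finite (8 / (2 ^ (n - 1) * PI) *
     sum_f_R0 (fun j : nat => Binomial.C n j * (1 / (INR n - 2 * INR j) ^ 2))
              ((n - 1) / 2)%nat)).
Proof.
  destruct hn as [m Hm]; subst n; set (n := (2 * m + 1)%nat).
  assert (HPI := PI_RGT_0).
  assert (Hlip := cos_pow_lipschitz n).
  assert (Hcont := lipschitz_continuous (fun x => cos x ^ n) _ Hlip).
  assert (Hlim := is_lim_seq_RInt_oscillation (fun x => cos x ^ n) (fun x => cos x ^ n)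
    (INR n) PI HPI Hlip Hcont).
  set (w := fun j => INR n - 2 * INR j).
  assert (Hw : forall j, w j <> 0) by apply odd_minus_double_neq0.
  (* the first and second termwise antiderivatives of cos x ^ n *)
  set (F := fun x => / 2 ^ n * sum_f_R0 (fun j => Binomial.C n j * (sin (w j * x) / w j)) n).
  set (H := fun x => / 2 ^ n * sum_f_R0 (fun j => Binomial.C n j * (- cos (w j * x) / w j ^ 2)) n).
  assert (H2n : forall i, 2 ^ i <> 0) by (intros; apply pow_nonzero; lra).
  assert (HF : forall x, is_derive F x (cos x ^ n)).
  { intros x.
    replace (cos x ^ n) with (/ 2 ^ n * sum_f_R0 (fun j => Binomial.C n j * cos (w j * x)) n).
    - apply is_derive_scal.
      apply (is_derive_sum_f_R0 (fun j x => Binomial.C n j * (sin (w j * x) / w j))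
               (fun j x => Binomial.C n j * cos (w j * x))).
      intros j _; auto_derive; [easy|field; apply Hw].
    - rewrite (sum_eq _ (fun j => Binomial.C n j * cos (0 + (INR n - 2 * INR j) * x)))
        by (intros; now rewrite Rplus_0_l).
      rewrite cos_pow_fourier, cos_0; field; apply H2n. }
  assert (HH : forall x, is_derive H x (F x)).
  { intros x; apply is_derive_scal.
    apply (is_derive_sum_f_R0 (fun j x => Binomial.C n j * (- cos (w j * x) / w j ^ 2))
             (fun j x => Binomial.C n j * (sin (w j * x) / w j))).
    intros j _; auto_derive; [easy|field; apply Hw]. }
  assert (Hzero : forall x, (forall j, sin (w j * x) = 0) -> F x = 0).
  { intros x Hx; unfold F; rewrite (sum_eq _ (fun _ => 0)).
    - rewrite sum_cte; ring.
    - intros j _; rewrite Hx; field; apply Hw. }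
  rewrite (RInt_RInt_dist_decreasing (fun x => cos x ^ n) F H) in Hlim; auto.
  - replace (8 / _ * _) with (4 * (H PI - H 0) / PI).
    { apply Hlim; intros x; [now rewrite cos_neg|].
      f_equal; rewrite <- (cos_period x 1); f_equal; simpl; ring. }
    replace ((n - 1) / 2)%nat with m
      by (unfold n; rewrite Nat.add_sub, Nat.mul_comm, Nat.div_mul; lia).
    (* each frequency is odd, so the cosine drops by 2 between 0 and PI *)
    replace (H PI - H 0) with
      (/ 2 ^ n * (2 * sum_f_R0 (fun j => Binomial.C n j * (1 / w j ^ 2)) n)).
    2:{ unfold H; rewrite <- Rmult_minus_distr_l, <- minus_sum, scal_sum; f_equal.
        apply sum_eq; intros j _.
        replace (cos (w j * PI)) with (-1) by (symmetry; apply trig_odd_PI).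
        rewrite Rmult_0_r, cos_0.
        field; apply Hw. }
    (* the frequencies for j and n - j are opposite, so their squares agree *)
    unfold n at 3; rewrite sum_fold_half; fold n.
    rewrite (sum_eq _ (fun j => Binomial.C n j * (1 / w j ^ 2) * 2)).
    + rewrite <- scal_sum.
      replace (2 ^ n) with (2 * 2 ^ (n - 1))
        by (unfold n; rewrite Nat.add_sub, pow_add; ring).
      unfold w; field; split; [lra|apply H2n].
    + intros j Hj; rewrite <- pascal_step1 by (unfold n; lia).
      replace (w (n - j)%nat) with (- w j)
        by (unfold w; rewrite minus_INR by (unfold n; lia); ring).
      field; apply Hw.
  - lra.
  - intros x y Hx Hxy Hy; apply pow_odd_le, cos_decr_1; lra.
  - apply Hzero; intros j; rewrite Rmult_0_r; apply sin_0.
  - apply Hzero; intros j; apply trig_odd_PI.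
Qed.
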